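(* Consider the extended reformulation (P) of a signomial geometric program given in the context. Let $K'\subset K$, and for each $k\in K'$ let $J_k\subseteq C_k^-$. Suppose that for every $k\in K'$, $j\in J_k$ and every $i\in N$ with $a_{ijk}\ne 0$, the variable $x_i$ has an upper bound $\overline{x}_i>0$ (i.e. $x_i\le\overline{x}_i$ at every feasible point), and that $$\overline{X}_{jk}=c'_{jk}\prod_{i\in N:\,a_{ijk}\neq 0}\overline{x}_i^{\,a_{ijk}}$$ is an upper bound of the monomial $g_{jk}(x)=c'_{jk}\prod_{i\in N}x_i^{a_{ijk}}$ (i.e. $g_{jk}(x)\le\overline{X}_{jk}$ at every feasible point). Then the inequalities $$\gamma_{jk}\le\frac{\overline{X}_{jk}}{c'_{jk}},\qquad\forall j\in J_k,\ k\in K',$$ are valid for (P). Further, for each $k\in K'$ with $J_k=C_k^-$, the inequality $$\sum_{j\in C_k^+}c_{jk}\lambda_{jk}\le\sum_{j\in C_k^-}\overline{X}_{jk}$$ is also valid for (P).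
   Context: An inequality is valid for a problem if it holds at every feasible point of the problem. Signomial geometric program (SGP): minimize $f_0(x)$ subject to $f_k(x)\le 1$ for $k=1,\dots,p$ and $x\in\mathbb{R}^n$, $x>0$, where $f_k(x)=\sum_{j=1}^{m_k}c_{jk}\prod_{i=1}^n x_i^{a_{ijk}}$ with real $c_{jk}$, $a_{ijk}$. Introducing variables $x_{n+1},x_{n+2}>0$, the objective becomes $x_{n+1}-x_{n+2}$ with the added constraint $f_0(x)\le x_{n+1}-x_{n+2}$. Moving negative terms to the right-hand side gives, with $N=\{1,\dots,n+2\}$ and $K=\{0,1,\dots,p\}$, $$\min\ d^Tx\quad\text{s.t.}\quad\sum_{j\in C_k^+}c_{jk}\prod_{i\in N}x_i^{a_{ijk}}\le\sum_{j\in C_k^-}c'_{jk}\prod_{i\in N}x_i^{a_{ijk}}\ \ \forall k\in K,\qquad x>0,$$ where $d=(0,\dots,0,1,-1)\in\mathbb{R}^{n+2}$. Here $C_k^+$ indexes the monomials of constraint $k$ with positive coefficients $c_{jk}>0$ (for $k=0$ it also includes the monomial $x_{n+2}$ with coefficient $1$), and $C_k^-$ indexes those with negative coefficients, with $c'_{jk}=-c_{jk}>0$ (it also includes the monomial $x_{n+1}$ with coefficient $1$ for $k=0$, and the constant monomial $1$ with coefficient $1$ for $k\ge 1$). The extended reformulation (P), in real variables $x_i,\tilde{x}_i$ ($i\in N$), $\lambda_{jk}$ ($j\in C_k^+$, $k\in K$), $\gamma_{jk},\tilde{\gamma}_{jk}$ ($j\in C_k^-$, $k\in K$), is: minimize $d^Tx$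 subject to - $\sum_{j\in C_k^+}c_{jk}\lambda_{jk}\le\sum_{j\in C_k^-}c'_{jk}\gamma_{jk}$ for all $k\in K$; - $\exp\big(\sum_{i\in N}a_{ijk}\tilde{x}_i\big)\le\lambda_{jk}$ for all $j\in C_k^+$, $k\in K$; - $\tilde{\gamma}_{jk}\le\sum_{i\in N}a_{ijk}\tilde{x}_i$ for all $j\in C_k^-$, $k\in K$; - $e^{\tilde{x}_i}\le x_i$ and $x_i\le e^{\tilde{x}_i}$ for all $i\in N$; - $e^{\tilde{\gamma}_{jk}}\le\gamma_{jk}$ and $\gamma_{jk}\le e^{\tilde{\gamma}_{jk}}$ for all $j\in C_k^-$, $k\in K$; - $x>0$. The variable upper bounds $x_i\le\overline{x}_i$ that are available are understood to hold at feasible points of (P). *)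

(* Defs.v *)
From HB Require Import structures.
From mathcomp Require Import all_boot all_order all_algebra.
From mathcomp Require Import reals sequences exp.
Set Implicit Arguments.
Unset Strict Implicit.
Unset Printing Implicit Defensive.
Import Order.TTheory GRing.Theory Num.Theory.
Local Open Scope ring_scope.

(* Data of the signomial geometric program
     minimize f_0(x)  s.t.  f_k(x) <= 1 (k = 1..p),  x > 0 in R^n,
     f_k(x) = \sum_(j < m_k) c_jk \prod_(i < n) x_i `^ a_ijk,
   with n = nvar, p = ncon, m_k = nmon k, c_jk = fcoef k j and
   a_ijk = fexpo k j i; k = ord0 is the objective. *)
Record sgp (R : realType) := SGP {
  nvar : nat;
  ncon : nat;
  nmon : 'I_ncon.+1 -> nat;
  fcoef : forall k : 'I_ncon.+1, 'I_(nmon k) -> R;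
  fexpo : forall k : 'I_ncon.+1, 'I_(nmon k) -> 'I_nvar -> R
}.

(* N = {1, .., n + 2}: lshift embeds the original variables; rshift of 0 and 1
   are the variables x_{n+1} and x_{n+2} of the epigraph form
     minimize x_{n+1} - x_{n+2}  s.t.  f_0(x) <= x_{n+1} - x_{n+2}. *)
Notation N S := 'I_(nvar S + 2).
Notation K S := 'I_(ncon S).+1.

Definition xn1 (R : realType) (S : sgp R) : N S := rshift (nvar S) (@Ordinal 2 0 isT).
Definition xn2 (R : realType) (S : sgp R) : N S := rshift (nvar S) (@Ordinal 2 1 isT).

(* Monomials of constraint k once all its terms are on the left-hand side:
     f_0(x) - x_{n+1} + x_{n+2} <= 0   for k = 0,
     f_k(x) - 1 <= 0                   for k >= 1.
   inl j is the j-th monomial of f_k. For k = 0, inr 0 and inr 1 are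
   - x_{n+1} and + x_{n+2}; for k >= 1, inr 0 is the constant - 1. *)
Definition mono (R : realType) (S : sgp R) (k : K S) : finType :=
  ('I_(nmon k) + 'I_(if k == ord0 then 2 else 1))%type.

Definition coef (R : realType) (S : sgp R) (k : K S) (j : mono k) : R :=
  match j with
  | inl j0 => fcoef j0
  | inr s => if val s == 0%N then -1 else 1
  end.

Definition expo (R : realType) (S : sgp R) (k : K S) (j : mono k) (i : N S) : R :=
  match j with
  | inl j0 => match split i with inl i0 => fexpo j0 i0 | inr _ => 0 end
  | inr s =>
      if k == ord0 then (i == (if val s == 0%N then xn1 S else xn2 S))%:R else 0
  end.

(* C_k^+ and C_k^-; a monomial with zero coefficient belongs to neither. *)
Definition Cpos (R : realType) (S : sgp R) (k : K S) : finType :=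
  {j : mono k | 0 < coef j}.
Definition Cneg (R : realType) (S : sgp R) (k : K S) : finType :=
  {j : mono k | coef j < 0}.

Definition cpos (R : realType) (S : sgp R) (k : K S) (j : Cpos k) : R :=
  coef (val j).
(* c'_jk = - c_jk *)
Definition cneg (R : realType) (S : sgp R) (k : K S) (j : Cneg k) : R :=
  - coef (val j).

(* d = (0, .., 0, 1, -1) *)
Definition dvec (R : realType) (S : sgp R) (i : N S) : R :=
  if i == xn1 S then 1 else if i == xn2 S then -1 else 0.

Record problem (R : realType) (T : Type) := Problem {
  objective : T -> R;
  feasible : T -> Prop
}.

Definition valid (R : realType) (T : Type) (Q : problem R T) (ineq : T -> Prop) :=
  forall z : T, feasible Q z -> ineq z.

(* lx and lgam are the variables written with a tilde. *)
Record point (R : realType) (S : sgp R) := Point {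
  x : N S -> R;
  lx : N S -> R;
  lam : forall k : K S, Cpos k -> R;
  gam : forall k : K S, Cneg k -> R;
  lgam : forall k : K S, Cneg k -> R
}.

Record ext_feasible (R : realType) (S : sgp R) (z : point S) : Prop := {
  ext_lin : forall k : K S,
    \sum_(j : Cpos k) cpos j * lam z j <= \sum_(j : Cneg k) cneg j * gam z j;
  ext_lam : forall (k : K S) (j : Cpos k),
    expR (\sum_(i : N S) expo (val j) i * lx z i) <= lam z j;
  ext_lgam : forall (k : K S) (j : Cneg k),
    lgam z j <= \sum_(i : N S) expo (val j) i * lx z i;
  ext_x_lb : forall i : N S, expR (lx z i) <= x z i;
  ext_x_ub : forall i : N S, x z i <= expR (lx z i);
  ext_gam_lb : forall (k : K S) (j : Cneg k), expR (lgam z j) <= gam z j;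
  ext_gam_ub : forall (k : K S) (j : Cneg k), gam z j <= expR (lgam z j);
  ext_x_gt0 : forall i : N S, 0 < x z i
}.

(* The extended reformulation (P). *)
Definition ext_problem (R : realType) (S : sgp R) : problem R (point S) :=
  Problem (fun z => \sum_(i : N S) dvec i * x z i) (@ext_feasible R S).

Definition gmon (R : realType) (S : sgp R) (k : K S) (j : Cneg k) (y : N S -> R) : R :=
  cneg j * \prod_(i : N S) y i `^ expo (val j) i.

(* Only the bounds of the variables occurring in the monomial are used. *)
Definition Xbar (R : realType) (S : sgp R) (xbar : N S -> R)
    (k : K S) (j : Cneg k) : R :=
  cneg j * \prod_(i : N S | expo (val j) i != 0) xbar i `^ expo (val j) i.

(* Main.v *)
Require Import Defs.
From HB Require Import structures.
From mathcomp Require Import all_boot all_order all_algebra.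
From mathcomp Require Import reals sequences exp.
Set Implicit Arguments.
Unset Strict Implicit.
Unset Printing Implicit Defensive.
Import Order.TTheory GRing.Theory Num.Theory.
Local Open Scope ring_scope.

(** At a feasible point the two-sided constraints force [x = exp lx], so that a
    monomial in [x] is the exponential of a linear form in [lx]
    ([monomialE]).  Since [lgam] lies below that linear form, monotonicity of
    the exponential gives, with exponents [a],
      [gam <= exp lgam <= exp (\sum_i a_i * lx_i) = \prod_i x_i `^ a_i],
    that is, [cneg * gam] never exceeds the monomial [gmon] at [x]
    ([cneg_gam_le_gmon]).  Hence any valid upper bound of the monomial bounds
    [gam] after division by [cneg > 0].  When all the monomials of [Cneg k] are
    bounded, the sum of their bounds dominates the right-hand side of the linear
    constraint [k], hence also its left-hand side. *)

Lemma cneg_gt0 (R : realType) (S : sgp R) (k : K S) (j : Cneg k) : 0 < cneg j.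
Proof. by rewrite oppr_gt0 (valP j). Qed.

Lemma ext_xE (R : realType) (S : sgp R) (z : point S) (i : N S) :
  ext_feasible z -> x z i = expR (lx z i).
Proof.
by move=> zP; apply: le_anti; rewrite (ext_x_ub zP) (ext_x_lb zP).
Qed.

(** Raising [exp (lx i)] to the power [a i] multiplies exponents, and the
    exponential turns the sum over [i] into a product. *)
Lemma monomialE (R : realType) (S : sgp R) (z : point S) (a : N S -> R) :
  ext_feasible z ->
  \prod_(i : N S) x z i `^ a i = expR (\sum_(i : N S) a i * lx z i).
Proof.
move=> zP; rewrite expR_sum; apply: eq_bigr => i _.
by rewrite (ext_xE i zP) mulrC expRM.
Qed.

Lemma gam_le_monomial (R : realType) (S : sgp R) (z : point S) (k : K S)
    (j : Cneg k) :
  ext_feasible z -> gam z j <= \prod_(i : N S) x z i `^ expo (val j) i.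
Proof.
move=> zP; rewrite monomialE //; apply: (le_trans (ext_gam_ub zP j)).
by rewrite ler_expR (ext_lgam zP).
Qed.

Lemma cneg_gam_le_gmon (R : realType) (S : sgp R) (z : point S) (k : K S)
    (j : Cneg k) :
  ext_feasible z -> cneg j * gam z j <= gmon j (x z).
Proof. by move=> zP; rewrite ler_pM2l ?cneg_gt0 ?gam_le_monomial. Qed.

Theorem proposition4 (R : realType) (S : sgp R)
    (K' : {set K S}) (J : forall k : K S, {set Cneg k}) (xbar : N S -> R)
    (xbarP : forall (k : K S) (j : Cneg k) (i : N S),
       k \in K' -> j \in J k -> expo (val j) i != 0 ->
       0 < xbar i /\ valid (ext_problem S) (fun z => x z i <= xbar i))
    (XbarP : forall (k : K S) (j : Cneg k), k \in K' -> j \in J k ->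
       valid (ext_problem S) (fun z => gmon j (x z) <= Xbar xbar j)) :
  (forall (k : K S) (j : Cneg k), k \in K' -> j \in J k ->
     valid (ext_problem S) (fun z => gam z j <= Xbar xbar j / cneg j)) /\
  (forall k : K S, k \in K' -> J k = [set: Cneg k] ->
     valid (ext_problem S)
       (fun z => \sum_(j : Cpos k) cpos j * lam z j
                 <= \sum_(j : Cneg k) Xbar xbar j)).
Proof.
have gamP (k : K S) (j : Cneg k) (z : point S) : k \in K' -> j \in J k ->
    ext_feasible z -> cneg j * gam z j <= Xbar xbar j.
  move=> kK' jJ zP.
  exact: le_trans (cneg_gam_le_gmon j zP) (XbarP k j kK' jJ z zP).
split=> [k j kK' jJ z zP | k kK' JT z zP].
  by rewrite ler_pdivlMr ?cneg_gt0 // mulrC gamP.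
apply: (le_trans (ext_lin zP k)); apply: ler_sum => j _.
by rewrite gamP // JT inE.
Qed.
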